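(* Let $F:\mathbb{R}^d\to\mathbb{R}$ be convex and differentiable. Let $x$ be a point, $d$ a descent direction at $x$, $\alpha_0>0$ an initial step-size, $c\in(0,1)$, and $0<\epsilon<\rho<1$. Then, given the same inputs $\alpha_0,c,\rho$ (for the same $x$ and $d$), adaptive backtracking line search (ABLS) takes no more function evaluations to return a feasible step-size than regular backtracking line search (BLS) does.
   Context: A direction $d$ is a descent direction at $x$ if $\langle\nabla F(x),d\rangle<0$. The Armijo condition for a step-size $\alpha>0$ is $$F(x+\alpha d)-F(x)\le c\,\alpha\langle\nabla F(x),d\rangle;$$ a step-size satisfying it is called feasible. Define the violation $$v(\alpha)=\frac{F(x+\alpha d)-F(x)}{c\,\alpha\langle\nabla F(x),d\rangle},$$ so that, for a descent direction, the Armijo condition is equivalent to $v(\alpha)\ge1$, and define $$\hat\rho(v(\alpha))=\max\Bigl(\epsilon,\ \rho\,\frac{1-c}{1-c\,v(\alpha)}\Bigr).$$ BLS: set $\alpha\gets\alpha_0$; while $v(\alpha)<1$, set $\alpha\gets\rho\,\alpha$; return $\alpha$. ABLS: set $\alpha\gets\alpha_0$; while $v(\alpha)<1$, set $\alpha\gets\hat\rho(v(\alpha))\,\alpha$; return $\alpha$. Function evaluations are counted as: one evaluation of $F(x)$, plus one evaluation of $F(x+\alpha d)$ for each tentative step-size $\alpha$ tested. *)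

(* Defs.v *)
From HB Require Import structures.
From mathcomp Require Import all_boot all_order all_algebra.
From mathcomp Require Import all_classical all_reals all_analysis.

Set Implicit Arguments.
Unset Strict Implicit.
Unset Printing Implicit Defensive.

Import Order.TTheory GRing.Theory Num.Theory.
Import numFieldNormedType.Exports.

Local Open Scope classical_set_scope.
Local Open Scope ring_scope.

Section LineSearch.
Variables (R : realType) (n : nat).
Implicit Types (F : 'rV[R]_n -> R) (x d u w : 'rV[R]_n) (c alpha : R).

Definition inner u w : R := \sum_(i < n) u 0 i * w 0 i.

Definition gradient F x : 'rV[R]_n := \row_(i < n) 'D_(delta_mx 0 i) F x.

Definition descent_direction F x d : Prop := inner (gradient F x) d < 0.

Definition armijo F x d c alpha : Prop :=
  F (x + alpha *: d) - F x <= c * alpha * inner (gradient F x) d.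

Definition feasible F x d c alpha : Prop := 0 < alpha /\ armijo F x d c alpha.

Definition violation F x d c alpha : R :=
  (F (x + alpha *: d) - F x) / (c * alpha * inner (gradient F x) d).

Definition rho_hat (c rho eps v : R) : R :=
  Num.max eps (rho * ((1 - c) / (1 - c * v))).

(* [backtrack v factor alpha k beta m]: the loop
   "while v(alpha) < 1, set alpha <- factor(v(alpha)) * alpha; return alpha",
   entered with step-size alpha after k function evaluations, halts and returns
   beta, with m function evaluations made in total.  Each step-size tested
   costs one evaluation (of F at x + alpha d), the accepted one included. *)
Inductive backtrack (v factor : R -> R) (alpha : R) (k : nat) (beta : R)
    (m : nat) : Prop :=
| backtrack_return of 1 <= v alpha & beta = alpha & m = k.+1
| backtrack_shrink of v alpha < 1 &
    backtrack v factor (factor (v alpha) * alpha) k.+1 beta m.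

(* The counter starts at 1 in both searches: the evaluation of F x. *)
Definition BLS F x d (alpha0 c rho beta : R) (m : nat) : Prop :=
  backtrack (violation F x d c) (fun=> rho) alpha0 1 beta m.

Definition ABLS F x d (alpha0 c rho eps beta : R) (m : nat) : Prop :=
  backtrack (violation F x d c) (rho_hat c rho eps) alpha0 1 beta m.

End LineSearch.

(* Main.v *)
(* Convexity makes the violation nonincreasing in the step-size, and
   differentiability makes it tend to 1/c > 1 at 0+, so BLS halts.  When v < 1
   the adaptive factor lies in (0, rho), hence by induction the k-th tentative
   step of ABLS is at most that of BLS; by monotonicity it is feasible as soon
   as the latter is. *)
Require Import Defs.
From HB Require Import structures.
From mathcomp Require Import all_boot all_order all_algebra.
From mathcomp Require Import all_classical all_reals all_analysis.
From mathcomp Require Import ring lra.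

Import Order.TTheory GRing.Theory Num.Theory.
Import numFieldNormedType.Exports.

Local Open Scope classical_set_scope.
Local Open Scope ring_scope.

Lemma backtrack_det {R : realType} {v factor : R -> R} {alpha k beta beta' m m'} :
  backtrack v factor alpha k beta m -> backtrack v factor alpha k beta' m' ->
  beta = beta' /\ m = m'.
Proof.
elim=> {alpha k beta m} [alpha k beta m v1 -> ->|alpha k beta m v1 _ IH].
  by case=> [_ -> ->//|]; rewrite ltNge v1.
by case=> [|_ /IH//]; rewrite leNgt v1.
Qed.

Lemma backtrack_gt0 (R : realType) (v factor : R -> R) alpha k beta m :
  (forall t, t < 1 -> 0 < factor t) -> 0 < alpha ->
  backtrack v factor alpha k beta m -> 0 < beta /\ 1 <= v beta.
Proof.
move=> f0 a0 H; elim: H a0 => {alpha k beta m} [alpha k beta m v1 -> //|].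
by move=> alpha k beta m v1 _ IH a0; apply: IH; rewrite mulr_gt0 ?f0.
Qed.

(** Reduces termination to exhibiting one acceptable [r ^+ j * alpha]. The loop may stop before [j]
    shrinks, so [beta] and [m] are left existential. *)
Lemma backtrack_geometric (R : realType) (v : R -> R) (r : R) j alpha k :
  1 <= v (r ^+ j * alpha) ->
  exists beta m, backtrack v (fun=> r) alpha k beta m.
Proof.
elim: j alpha k => [|j IH] alpha k vj.
  rewrite expr0 mul1r in vj.
  by exists alpha, k.+1; exact: backtrack_return.
have [v1|v1] := leP 1 (v alpha).
  by exists alpha, k.+1; exact: backtrack_return.
rewrite exprSr -mulrA in vj.
have [beta [m bt]] := IH _ k.+1 vj.
by exists beta, m; exact: backtrack_shrink.
Qed.

(** Induction on the run with [f], keeping the other step-size below it. The factors are compared at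
    unrelated arguments [s] and [t] because the two runs see different violations. *)
Lemma backtrack_le (R : realType) (v f f' : R -> R) alpha alpha' k beta m :
  (forall a b, 0 < a -> a <= b -> v b <= v a) ->
  (forall s t, s < 1 -> t < 1 -> f' s <= f t) ->
  (forall t, t < 1 -> 0 < f' t) ->
  0 < alpha' -> alpha' <= alpha ->
  backtrack v f alpha k beta m ->
  exists beta' m', backtrack v f' alpha' k beta' m' /\ (m' <= m)%N.
Proof.
move=> v_anti f'_le f'_gt0 a0 a_le H.
elim: H alpha' a0 a_le => {alpha k beta m} [alpha k beta m v1 _ ->|] alpha'.
  move=> a0 a_le; exists alpha', k.+1; split=> //.
  by apply: backtrack_return => //; exact: le_trans v1 (v_anti _ _ a0 a_le).
move=> k beta m v1 bt IH b b0 b_le.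
have [v1'|v1'] := leP 1 (v b).
  exists b, k.+1; split; first exact: backtrack_return.
  (* A run never ends with a count below its entry counter, here [k.+1]. *)
  by elim: bt {IH b b0 b_le v1'} => [? ? ? ? _ _ ->//|? ? ? ? _ _ /ltnW].
have [|| beta' [m' [bt' lem]]] := IH (f' (v b) * b).
- by rewrite mulr_gt0 ?f'_gt0.
- by rewrite ler_pM ?f'_le// ?ltW ?f'_gt0.
by exists beta', m'; split=> //; exact: backtrack_shrink.
Qed.

Lemma rho_hat_bounds (R : realType) (c rho eps t : R) :
  0 < c -> c < 1 -> 0 < eps -> eps < rho -> t < 1 ->
  0 < rho_hat c rho eps t <= rho.
Proof.
move=> c0 c1 e0 er t1.
(* Since [0 < 1 - c], this makes the denominator positive and the quotient in [rho_hat] at most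
   1. *)
have ct : 1 - c <= 1 - c * t by nra.
rewrite /rho_hat lt_max e0 /= ge_max (ltW er) /=.
by rewrite ger_pMr ?ler_pdivrMr ?mul1r//; lra.
Qed.

(** The differential is linear, so it can be expanded along the canonical basis. *)
Lemma derive_inner_gradient {R : realType} {n : nat} {F : 'rV[R]_n -> R} {x}
    (d : 'rV[R]_n) :
  differentiable F x -> 'D_d F x = inner (gradient F x) d.
Proof.
move=> dF; rewrite deriveE// [in LHS](row_sum_delta d) linear_sum /inner.
by apply: eq_bigr => i _; rewrite linearZ mxE deriveE// mulrC.
Qed.

Lemma convex_slope_le (R : realType) (n : nat) (F : 'rV[R]_n -> R)
    (x d : 'rV[R]_n) (a b : R) :
  convex_function [set: 'rV[R]_n] F -> 0 < a -> a <= b ->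
  (F (x + a *: d) - F x) / a <= (F (x + b *: d) - F x) / b.
Proof.
move=> cF a0 ab; have b0 : 0 < b := lt_le_trans a0 ab.
have t0 : 0 <= a / b by rewrite divr_ge0 ?ltW.
have t1 : a / b <= 1 by rewrite ler_pdivrMr// mul1r.
(* [x + a *: d] is the convex combination of [x + b *: d] and [x] with weight [a / b] on the
   former. *)
have := cF (Itv01 t0 t1) (x + b *: d) x; rewrite !in_setE => /(_ I I).
rewrite convRE /= [X in F X <= _](_ : _ = x + a *: d); last first.
  rewrite /conv /= scalerDr scalerA divfK ?gt_eqF// /unstable.onem.
  by rewrite scalerBl scale1r addrAC subrKC.
rewrite /unstable.onem => h.
rewrite ler_pdivrMr// mulrAC -mulrA.
by move: (a / b) h => t; lra.
Qed.

Section Descent.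
Context {R : realType} {n : nat} {F : 'rV[R]_n -> R} {x d : 'rV[R]_n} {c : R}.
Hypotheses (d_descent : descent_direction F x d) (c_gt0 : 0 < c).

Lemma violationE alpha :
  violation F x d c alpha =
  (F (x + alpha *: d) - F x) / alpha / (c * inner (gradient F x) d).
Proof. by rewrite /violation mulrAC invfM mulrA mulrAC. Qed.

Lemma violation_armijo alpha : 0 < alpha ->
  (1 <= violation F x d c alpha) <-> armijo F x d c alpha.
Proof.
move=> a0; rewrite /violation /armijo ler_ndivlMr ?mul1r//.
by rewrite pmulr_rlt0// mulr_gt0.
Qed.

(** The violation is the slope from [x] divided by a negative constant, which reverses the
    monotonicity of slopes. *)
Lemma violation_antitone a b : convex_function [set: 'rV[R]_n] F ->
  0 < a -> a <= b -> violation F x d c b <= violation F x d c a.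
Proof.
move=> cF a0 ab; rewrite !violationE ler_wnM2r ?convex_slope_le//.
by rewrite invr_le0 ltW// pmulr_rlt0.
Qed.

Lemma violation_near0 : c < 1 -> differentiable F x ->
  \forall alpha \near 0^'+, 1 <= violation F x d c alpha.
Proof.
move=> c1 dF; set g := inner (gradient F x) d.
have g0 : g < 0 := d_descent.
have slope : (F (x + h *: d) - F x) / h @[h --> 0^'+] --> g.
  rewrite /g -(derive_inner_gradient d dF); apply: cvg_dnbhs_at_right.
  under eq_fun do rewrite mulrC (addrC x).
  exact: diff_derivable.
(* As [g < 0] and [c < 1], the limit slope lies strictly below the Armijo threshold [c * g], hence
   so do the slopes at small steps. *)
have gc : g < c * g by nra.
near=> a.
have a0 : 0 < a by near: a; exact: nbhs_right_gt.
rewrite violationE ler_ndivlMr ?pmulr_rlt0// mul1r ltW//.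
by near: a; exact: cvgr_lt slope _ gc.
Unshelve. all: by end_near. Qed.

End Descent.

Theorem proposition5 (R : realType) (n : nat) (F : 'rV[R]_n -> R)
    (F_convex : convex_function [set: 'rV[R]_n] F)
    (F_diff : forall y : 'rV[R]_n, differentiable F y)
    (x d : 'rV[R]_n) (d_descent : descent_direction F x d)
    (alpha0 c rho eps : R) (alpha0_gt0 : 0 < alpha0)
    (c_gt0 : 0 < c) (c_lt1 : c < 1)
    (eps_gt0 : 0 < eps) (eps_lt_rho : eps < rho) (rho_lt1 : rho < 1) :
  (exists beta m, BLS F x d alpha0 c rho beta m) /\
  (exists beta' m', ABLS F x d alpha0 c rho eps beta' m') /\
  (forall (beta beta' : R) (m m' : nat),
     BLS F x d alpha0 c rho beta m ->
     ABLS F x d alpha0 c rho eps beta' m' ->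
     feasible F x d c beta /\ feasible F x d c beta' /\ (m' <= m)%N).
Proof.
have rho_gt0 : 0 < rho := lt_trans eps_gt0 eps_lt_rho.
have hat t : t < 1 -> 0 < rho_hat c rho eps t <= rho.
  by move=> t1; exact: rho_hat_bounds.
have hat_gt0 t : t < 1 -> 0 < rho_hat c rho eps t by move=> /hat /andP[].
have ABLS_le beta m : BLS F x d alpha0 c rho beta m ->
    exists beta' m', ABLS F x d alpha0 c rho eps beta' m' /\ (m' <= m)%N.
  apply: backtrack_le => // [a b|s t s1 _].
    exact: violation_antitone.
  (* The BLS factor is the constant [rho], so the bound at [s] alone suffices. *)
  by have /andP[] := hat _ s1.
have BLS_halts : exists beta m, BLS F x d alpha0 c rho beta m.
  (* The BLS steps eventually enter the right neighbourhood of 0 on which the violation is at least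
     1. *)
  have : rho ^+ j * alpha0 @[j --> \oo] --> 0.
    rewrite -(mul0r alpha0); apply: cvgM; last exact: cvg_cst.
    by apply: cvg_expr; rewrite gtr0_norm.
  have := violation_near0 d_descent c_gt0 c_lt1 (F_diff x).
  move=> [e /= e0 near_v] /cvgr0_norm_lt /(_ _ e0) [j _ /(_ j)].
  move=> /(_ (leqnn j)) small.
  apply: (@backtrack_geometric _ _ _ j).
  have pos : 0 < rho ^+ j * alpha0 by rewrite mulr_gt0 ?exprn_gt0.
  by apply: near_v => //; rewrite /ball_/= sub0r normrN.
split=> //; split.
  have [beta [m /ABLS_le[beta' [m' [? _]]]]] := BLS_halts.
  by exists beta', m'.
move=> beta beta' m m' bls abls.
have [b0 vb] : 0 < beta /\ 1 <= violation F x d c beta.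
  exact: backtrack_gt0 bls.
have [b0' vb'] : 0 < beta' /\ 1 <= violation F x d c beta'.
  exact: backtrack_gt0 abls.
(* [ABLS_le] only provides some ABLS run; determinism identifies its count with that of the given
   one. *)
have [beta2 [m2 [/(backtrack_det abls)[_ ->] le_m]]] :=
  ABLS_le _ _ bls.
by split; [|split] => //; split=> //; apply/violation_armijo.
Qed.
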